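(* Let $1\le p<\infty$, $p\ne 2$. There is no Schauder-Orlicz decomposition $\{\mathfrak{M}_n\}_{n=0}^{\infty}$ of $L_p=L_p(0,1)$ such that at least one of the subspaces $\mathfrak{M}_n$ is finite dimensional.
   Context: $L_p(0,1)$ is taken with Lebesgue measure and its usual norm. A Schauder decomposition of a Banach space $X$ is a sequence $\{\mathfrak{M}_n\}_{n=0}^{\infty}$ of closed nonzero linear subspaces of $X$ such that each $x\in X$ has a unique norm convergent expansion $x=\sum_{n=0}^{\infty}x_n$ with $x_n\in\mathfrak{M}_n$ for all $n$. Its associated sequence of coordinate projections (a.s.c.p.) $\{P_n\}_{n=0}^{\infty}$ is defined by $P_nx=x_n$; each $P_n$ is bounded. An Orlicz function is a continuous, nondecreasing, convex function $\Phi:[0,\infty)\to[0,\infty)$ with $\Phi(0)=0$ and $\lim_{t\to\infty}\Phi(t)=\infty$ (it may be degenerate, i.e. $\Phi(t)=0$ for some $t>0$). A Schauder decomposition of $X$ with a.s.c.p. $\{P_n\}$ is a Schauder-Orlicz decomposition (with Orlicz function $\Phi$) if there exists an Orlicz function $\Phi$ such that for every $x\in X$: $\inf\{\rho>0:\sum_{n=0}^{\infty}\Phi(\|P_nx\|/\rho)\le 1\}=\|x\|$. *)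

(* Defs.v *)
From HB Require Import structures.
From mathcomp Require Import all_boot all_order all_algebra.
From mathcomp Require Import all_classical all_reals all_analysis.
From mathcomp Require Import measurable_realfun complex.

Set Implicit Arguments.
Unset Strict Implicit.
Unset Printing Implicit Defensive.

Import Order.TTheory GRing.Theory Num.Theory.
Import numFieldNormedType.Exports.

Local Open Scope classical_set_scope.
Local Open Scope ring_scope.

(* Banach spaces over the reals and over the complex numbers are treated
   uniformly: [scalar_field R k] is [R] or [R[i]] according to [k]. *)
Inductive scalar_kind := Real_scalars | Complex_scalars.

Definition scalar_field (R : realType) (k : scalar_kind) : numFieldType :=
  match k with Real_scalars => R | Complex_scalars => R[i] end.

Definition re (R : realType) (k : scalar_kind) : scalar_field R k -> R :=
  match k with Real_scalars => id | Complex_scalars => @complex.Re R end.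

Definition im (R : realType) (k : scalar_kind) : scalar_field R k -> R :=
  match k with Real_scalars => fun=> 0 | Complex_scalars => @complex.Im R end.

Definition of_real (R : realType) (k : scalar_kind) : R -> scalar_field R k :=
  match k with Real_scalars => id | Complex_scalars => fun r => r%:C%C end.

(* A norm over [scalar_field R k] takes its values in [scalar_field R k]; they
   are nonnegative reals, and [rnorm] reads them in [R]. *)
Definition rnorm (R : realType) (k : scalar_kind)
  (X : normedZmodType (scalar_field R k)) (x : X) : R := re `|x|.

Section scalar_theory.
Context (R : realType) (k : scalar_kind).
Local Notation K := (scalar_field R k).
Implicit Types z w : K.

Lemma norm_rnorm z : `|z| = of_real k (rnorm z).
Proof.
by move: z; rewrite /rnorm; case: k => //= z; case: z.
Qed.

Lemma rnormE z : rnorm z = Num.sqrt (re z ^+ 2 + im z ^+ 2).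
Proof.
move: z; rewrite /rnorm; case: k => /= z.
  by rewrite expr0n addr0 sqrtr_sqr.
by case: z.
Qed.

Lemma rnorm_ge0 z : 0 <= rnorm z.
Proof. by rewrite rnormE sqrtr_ge0. Qed.

Lemma reD z w : re (z + w) = re z + re w.
Proof. by move: z w; case: k => //= -[a b] [c d]. Qed.

Lemma reM z w : re (z * w) = re z * re w - im z * im w.
Proof.
by move: z w; case: k => /= [z w|[a b] [c d]//]; rewrite mul0r subr0.
Qed.

Lemma imD z w : im (z + w) = im z + im w.
Proof. by move: z w; case: k => /= [z w|[a b] [c d]//]; rewrite addr0. Qed.

Lemma imM z w : im (z * w) = re z * im w + im z * re w.
Proof.
by move: z w; case: k => /= [z w|[a b] [c d]//]; rewrite mulr0 mul0r addr0.
Qed.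

Lemma re0 : re (0 : K) = 0. Proof. by case: k. Qed.

Lemma im0 : im (0 : K) = 0. Proof. by case: k. Qed.

Lemma of_realD (a b : R) : of_real k (a + b) = of_real k a + of_real k b.
Proof. by case: k => //=; rewrite rmorphD. Qed.

Lemma of_realM (a b : R) : of_real k (a * b) = of_real k a * of_real k b.
Proof. by case: k => //=; rewrite rmorphM. Qed.

Lemma of_real_inj : injective (of_real (R := R) k).
Proof. by case: k => //= a b []. Qed.

Lemma of_real0 : of_real (R := R) k 0 = 0. Proof. by case: k. Qed.

Lemma re_of_real (a : R) : re (of_real k a) = a. Proof. by case: k. Qed.

Lemma ler_of_real (a b : R) : (of_real k a <= of_real k b) = (a <= b).
Proof. by case: k => //=; rewrite lecR. Qed.

Lemma rnormM z w : rnorm (z * w) = rnorm z * rnorm w.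
Proof. by apply: of_real_inj; rewrite of_realM -!norm_rnorm normrM. Qed.

Lemma rnormD z w : rnorm (z + w) <= rnorm z + rnorm w.
Proof. by rewrite -ler_of_real of_realD -!norm_rnorm ler_normD. Qed.

Lemma rnorm0 : rnorm (0 : K) = 0.
Proof. by rewrite /rnorm normr0 re0. Qed.

Lemma rnorm0_eq0 z : rnorm z = 0 -> z = 0.
Proof. by move=> z0; apply/eqP; rewrite -normr_eq0 norm_rnorm z0 of_real0. Qed.

End scalar_theory.

Section Lspace.
Context d (T : measurableType d) (R : realType).
Variable mu : {measure set T -> \bar R}.
Variables (k : scalar_kind) (p : R).
Local Notation K := (scalar_field R k).
Implicit Types f g : T -> K.

(* [Lfun mu p] is the library's set of measurable real functions with finite
   [p]-norm. *)
Definition scalar_Lfun (p1 : 1 <= p) : {pred T -> K} :=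
  [pred f : T -> K | `[< measurable_fun [set: T] (@re R k \o f) >]
    && (`[< measurable_fun [set: T] (@im R k \o f) >]
    && ((fun x => rnorm (f x)) \in Lfun mu p%:E))].

Definition scalar_Lnorm f : R :=
  fine ('N[mu]_p%:E[EFin \o (fun x => rnorm (f x))]).

Context (p1 : 1 <= p).

Let p_gt0 : 0 < p. Proof. exact: lt_le_trans p1. Qed.

Lemma scalar_LfunP f : reflect
  [/\ measurable_fun [set: T] (@re R k \o f),
      measurable_fun [set: T] (@im R k \o f) &
      (fun x => rnorm (f x)) \in Lfun mu p%:E]
  (f \in scalar_Lfun p1).
Proof.
apply: (iffP and3P) => [[/asboolP ? /asboolP ? ?]|[? ? ?]]; first by split.
by split => //; apply/asboolP.
Qed.

Lemma measurable_rnorm f : measurable_fun [set: T] (@re R k \o f) ->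
  measurable_fun [set: T] (@im R k \o f) ->
  measurable_fun [set: T] (fun x => rnorm (f x)).
Proof.
move=> mr mi; have -> : (fun x => rnorm (f x)) =
    (@Num.sqrt R) \o (fun x => re (f x) ^+ 2 + im (f x) ^+ 2).
  by apply/funext => x; rewrite rnormE.
apply: measurableT_comp.
  by apply: continuous_measurable_fun; exact: sqrt_continuous.
by apply: measurable_funD; apply: measurable_funX.
Qed.

Lemma ge0_le_Lnorm (u v : T -> R) : measurable_fun [set: T] u ->
  measurable_fun [set: T] v -> (forall x, 0 <= u x <= v x) ->
  ('N[mu]_p%:E[EFin \o u] <= 'N[mu]_p%:E[EFin \o v])%E.
Proof.
move=> meas_u mv uv; rewrite unlock /=.
have mP (w : T -> R) : measurable_fun [set: T] w ->
    measurable_fun [set: T] (fun x => (`|w x| `^ p)%:E).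
  move=> mw; apply/measurable_EFinP.
  apply: (@measurableT_comp _ _ _ _ _ _ (@powR R ^~ p)) => //.
  exact: measurableT_comp.
apply: gt0_ler_poweR.
- by rewrite invr_ge0 ltW.
- by rewrite in_itv/= leey andbT integral_ge0// => x _;
    rewrite lee_fin powR_ge0.
- by rewrite in_itv/= leey andbT integral_ge0// => x _;
    rewrite lee_fin powR_ge0.
- apply: ge0_le_integral => //; [exact: mP|exact: mP|move=> x _].
  have /andP[u0 uvx] := uv x.
  rewrite lee_fin ge0_ler_powR ?nnegrE ?normr_ge0// ?(ltW p_gt0)//.
  by rewrite !ger0_norm// (le_trans u0).
Qed.

Lemma LfunE (u : T -> R) : u \in Lfun mu p%:E ->
  measurable_fun [set: T] u /\ finite_norm mu p%:E u.
Proof. by case/andP; rewrite !inE. Qed.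

Lemma in_Lfun (u : T -> R) : measurable_fun [set: T] u ->
  finite_norm mu p%:E u -> u \in Lfun mu p%:E.
Proof. by move=> meas_u fu; apply/andP; rewrite !inE. Qed.

Lemma ge0_Lfun_le (u v : T -> R) : measurable_fun [set: T] u ->
  v \in Lfun mu p%:E -> (forall x, 0 <= u x <= v x) -> u \in Lfun mu p%:E.
Proof.
move=> meas_u /LfunE[mv fv] uv; apply: in_Lfun => //.
exact: le_lt_trans (ge0_le_Lnorm meas_u mv uv) fv.
Qed.

Let p1e : (1 <= p%:E)%E. Proof. by rewrite lee_fin. Qed.

Lemma scalar_Lfun_submod_closed : submod_closed (scalar_Lfun p1).
Proof.
split=> [|a f g /scalar_LfunP[mrf mif Lf] /scalar_LfunP[mrg mig Lg]].
- apply/scalar_LfunP; split.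
  + rewrite (_ : _ \o _ = cst 0)//; by apply/funext => x /=; rewrite re0.
  + rewrite (_ : _ \o _ = cst 0)//; by apply/funext => x /=; rewrite im0.
  + rewrite (_ : (fun _ => _) = 0); last by apply/funext => x; rewrite rnorm0.
    by have [] := Lfun_submod_closed mu p1e.
- have mr : measurable_fun [set: T] (@re R k \o (a *: f + g)).
    rewrite (_ : _ \o _ = fun x =>
      re a * re (f x) - im a * im (f x) + re (g x)); last first.
      by apply/funext => x /=; rewrite reD reM.
    apply: measurable_funD => //; apply: measurable_funB;
      exact: measurable_funM.
  have mi : measurable_fun [set: T] (@im R k \o (a *: f + g)).
    rewrite (_ : _ \o _ = fun x =>
      re a * im (f x) + im a * re (f x) + im (g x)); last first.
      by apply/funext => x /=; rewrite imD imM.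
    apply: measurable_funD => //; apply: measurable_funD;
      exact: measurable_funM.
  apply/scalar_LfunP; split => //.
  have Lv := (Lfun_submod_closed mu p1e).2 (rnorm a) _ _ Lf Lg.
  apply: ge0_Lfun_le Lv _ => [|x]; first exact: measurable_rnorm.
  by rewrite rnorm_ge0/= (le_trans (rnormD _ _))// rnormM.
Qed.

HB.instance Definition _ := GRing.isSubmodClosed.Build _ _ (scalar_Lfun p1)
  scalar_Lfun_submod_closed.

Record scalar_LfunType := ScalarLfun {
  scalar_Lfun_val :> T -> K;
  _ : scalar_Lfun_val \in scalar_Lfun p1 }.

HB.instance Definition _ := [isSub for scalar_Lfun_val].
HB.instance Definition _ := [Choice of scalar_LfunType by <:].
HB.instance Definition _ := [SubChoice_isSubLmodule of scalar_LfunType by <:].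

Local Notation F := scalar_LfunType.

Lemma scalar_Lfun_valD (f g : F) x : (f + g) x = f x + g x. Proof. by []. Qed.

Lemma scalar_Lfun_valB (f g : F) x : (f - g) x = f x - g x. Proof. by []. Qed.

Lemma scalar_Lfun_valZ a (f : F) x : (a *: f) x = a * f x. Proof. by []. Qed.

Definition ae_zero : {pred F} :=
  [pred f : F | `[< {ae mu, forall x, f x = 0} >]].

Lemma ae_zero_zmod_closed : zmod_closed ae_zero.
Proof.
split=> [|f g /asboolP f0 /asboolP g0]; apply/asboolP; first exact: aeW.
by apply: filterS2 f0 g0 => x fx gx; rewrite scalar_Lfun_valB fx gx subr0.
Qed.

HB.instance Definition _ := GRing.isZmodClosed.Build F ae_zero
  ae_zero_zmod_closed.

(* The library's [LspaceType] is the same quotient for real functions, but it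
   carries neither a vector space structure nor a norm. *)
Definition scalar_Lspace : Type := Quotient.quot ae_zero.

HB.instance Definition _ := GRing.Zmodule.on scalar_Lspace.
HB.instance Definition _ := EqQuotient.on scalar_Lspace.

Local Open Scope quotient_scope.

Local Notation pi := (\pi_scalar_Lspace : F -> scalar_Lspace).

Lemma scalar_Lspace_eqP (f g : F) :
  pi f = pi g <-> {ae mu, forall x, f x = g x}.
Proof.
split.
  move=> /eqP; rewrite -[_ == _]Quotient.idealrBE => /asboolP.
  by apply: filterS => x /eqP; rewrite scalar_Lfun_valB subr_eq0 => /eqP.
move=> fg; apply/eqP; rewrite -[_ == _]Quotient.idealrBE; apply/asboolP.
by apply: filterS fg => x fgx; rewrite scalar_Lfun_valB fgx subrr.
Qed.

Lemma repr_ae (f : F) : {ae mu, forall x, repr (pi f) x = f x}.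
Proof. by apply/scalar_Lspace_eqP; rewrite reprK. Qed.

Lemma pi_add (f g : F) : pi f + pi g = pi (f + g).
Proof. exact: (esym (@Quotient.pi_add F ae_zero f g)). Qed.

Definition Lspace_scale (a : K) (x : scalar_Lspace) : scalar_Lspace :=
  pi (a *: repr x).

Lemma pi_scale a (f : F) : Lspace_scale a (pi f) = pi (a *: f).
Proof.
apply/scalar_Lspace_eqP; apply: filterS (repr_ae f) => x fx.
by rewrite !scalar_Lfun_valZ fx.
Qed.

Lemma scalar_LspaceP (x : scalar_Lspace) : exists f : F, x = pi f.
Proof. by exists (repr x); rewrite reprK. Qed.

Lemma Lspace_scaleA a b x :
  Lspace_scale a (Lspace_scale b x) = Lspace_scale (a * b) x.
Proof. by have [f ->] := scalar_LspaceP x; rewrite !pi_scale scalerA. Qed.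

Lemma Lspace_scale1 : left_id 1 Lspace_scale.
Proof.
by move=> x; have [f ->] := scalar_LspaceP x; rewrite pi_scale scale1r.
Qed.

Lemma Lspace_scaleDr : right_distributive Lspace_scale +%R.
Proof.
move=> a x y; have [f ->] := scalar_LspaceP x; have [g ->] := scalar_LspaceP y.
by rewrite pi_add !pi_scale pi_add scalerDr.
Qed.

Lemma Lspace_scaleDl x : {morph Lspace_scale^~ x : a b / a + b}.
Proof.
move=> a b; have [f ->] := scalar_LspaceP x.
by rewrite !pi_scale pi_add scalerDl.
Qed.

HB.instance Definition _ := GRing.Zmodule_isLmodule.Build K scalar_Lspace
  Lspace_scaleA Lspace_scale1 Lspace_scaleDr Lspace_scaleDl.

Lemma scalar_Lnorm_fin (f : F) : (scalar_Lnorm f)%:E =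
  'N[mu]_p%:E[EFin \o (fun x => rnorm (f x))]%E.
Proof.
have /scalar_LfunP[_ _ /LfunE[_ fin]] := valP f.
by rewrite /scalar_Lnorm fineK// ge0_fin_numE// Lnorm_ge0.
Qed.

Lemma ae_eq_scalar_Lnorm (f g : F) :
  {ae mu, forall x, f x = g x} -> scalar_Lnorm f = scalar_Lnorm g.
Proof.
move=> fg; apply: EFin_inj; rewrite !scalar_Lnorm_fin unlock /=.
congr (_ `^ _)%E.
have mP (h : F) : measurable_fun [set: T] (fun x => (`|rnorm (h x)| `^ p)%:E).
  have /scalar_LfunP[_ _ /LfunE[mh _]] := valP h.
  apply/measurable_EFinP.
  apply: (@measurableT_comp _ _ _ _ _ _ (@powR R ^~ p)) => //.
  exact: measurableT_comp.
apply: ae_eq_integral => //=.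
by apply: filterS fg => x -> _.
Qed.

Lemma scalar_LnormD (f g : F) :
  scalar_Lnorm (f + g) <= scalar_Lnorm f + scalar_Lnorm g.
Proof.
have /scalar_LfunP[_ _ /LfunE[mf _]] := valP f.
have /scalar_LfunP[_ _ /LfunE[mg _]] := valP g.
have /scalar_LfunP[_ _ /LfunE[mfg _]] := valP (f + g).
rewrite -lee_fin EFinD !scalar_Lnorm_fin.
apply: le_trans (minkowski_EFin mu mf mg p1).
apply: (@ge0_le_Lnorm _
  ((fun x => rnorm (f x)) \+ (fun x => rnorm (g x)))) => //.
  exact: measurable_funD.
by move=> x /=; rewrite rnorm_ge0/= rnormD.
Qed.

Lemma scalar_LnormZ a (f : F) :
  scalar_Lnorm (a *: f) = rnorm a * scalar_Lnorm f.
Proof.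
have /scalar_LfunP[_ _ Lf] := valP f.
apply: EFin_inj; rewrite EFinM !scalar_Lnorm_fin.
have := LnormZ (Lfun_Sub p1e Lf) (rnorm a).
rewrite ger0_norm ?rnorm_ge0// => <-.
by apply: eq_Lnorm => x /=; rewrite rnormM.
Qed.

Definition Lspace_norm (x : scalar_Lspace) : K :=
  of_real k (scalar_Lnorm (repr x)).

Lemma Lspace_norm_pi (f : F) : Lspace_norm (pi f) = of_real k (scalar_Lnorm f).
Proof. by rewrite /Lspace_norm (ae_eq_scalar_Lnorm (repr_ae f)). Qed.

Lemma Lspace_normD x y : Lspace_norm (x + y) <= Lspace_norm x + Lspace_norm y.
Proof.
have [f ->] := scalar_LspaceP x; have [g ->] := scalar_LspaceP y.
rewrite pi_add !Lspace_norm_pi -of_realD ler_of_real.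
exact: scalar_LnormD.
Qed.

Lemma Lspace_normZ a x : Lspace_norm (a *: x) = `|a| * Lspace_norm x.
Proof.
have [f ->] := scalar_LspaceP x; rewrite [_ *: _]pi_scale.
rewrite !Lspace_norm_pi scalar_LnormZ of_realM.
by rewrite norm_rnorm.
Qed.

Lemma Lspace_norm0_eq0 x : Lspace_norm x = 0 -> x = 0.
Proof.
have [f ->] := scalar_LspaceP x; rewrite Lspace_norm_pi => f0.
have fz : scalar_Lnorm f = 0 by apply: (@of_real_inj R k); rewrite of_real0.
have /scalar_LfunP[_ _ /LfunE[/measurable_EFinP mf _]] := valP f.
have Nf0 : 'N[mu]_p%:E[EFin \o (fun x => rnorm (f x))]%E = 0%E.
  by rewrite -scalar_Lnorm_fin fz.
rewrite -[RHS](raddf0 pi); apply/scalar_Lspace_eqP.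
apply: filterS (Lnorm_eq0_eq0 mf _ Nf0); last by rewrite lte_fin.
by move=> y /(_ I)[/rnorm0_eq0].
Qed.

HB.instance Definition _ := Lmodule_isNormed.Build K scalar_Lspace
  Lspace_normD Lspace_normZ Lspace_norm0_eq0.

Lemma rnorm_pi (f : F) : rnorm (pi f) = scalar_Lnorm f.
Proof. by rewrite /rnorm [`|_|]Lspace_norm_pi re_of_real. Qed.

End Lspace.

(* Functions on the whole line, modulo equality almost everywhere for Lebesgue
   measure restricted to the open interval. *)
Definition Lp01 (R : realType) (k : scalar_kind) (p : R) (p1 : 1 <= p) :
    normedModType (scalar_field R k) :=
  scalar_Lspace (mrestr (@lebesgue_measure R) (measurable_itv `]0%R, 1%R[))
    k p1.

Section Schauder.
Context (K : numFieldType) (X : normedModType K).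
Implicit Type M : nat -> set X.

Definition expansion M (x : X) (u : nat -> X) : Prop :=
  (forall n, M n (u n)) /\ series u @ \oo --> x.

Definition Schauder_decomposition M : Prop :=
  (forall n, [/\ submod_closed (mem (M n)), closed (M n) &
                 exists2 x, M n x & x != 0]) /\
  (forall x, exists! u, expansion M x u).

Definition coord_proj M (n : nat) (x : X) : X := get (expansion M x) n.

Lemma coord_projP M x : Schauder_decomposition M ->
  expansion M x (fun n => coord_proj M n x).
Proof. by move=> [_ /(_ x)[u [Mxu _]]]; exact: (getI Mxu). Qed.

Definition finite_dimensional (S : set X) : Prop :=
  exists (m : nat) (v : 'I_m -> X), (forall i, S (v i)) /\
    forall x, S x -> exists a : 'I_m -> K, x = \sum_(i < m) a i *: v i.

End Schauder.

(* Only the values on the nonnegative half-line are relevant; there, they are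
   nonnegative because [Phi] is nondecreasing and vanishes at 0. *)
Definition Orlicz_function (R : realType) (Phi : R -> R) : Prop :=
  [/\ {within `[0, +oo[, continuous Phi},
      {in `[0, +oo[ &, {homo Phi : s t / s <= t}},
      convex_function (`[0, +oo[%classic : set R) Phi,
      Phi 0 = 0 & Phi t @[t --> +oo] --> +oo].

Definition Schauder_Orlicz_decomposition (R : realType) (k : scalar_kind)
    (X : normedModType (scalar_field R k)) (M : nat -> set X) : Prop :=
  Schauder_decomposition M /\
  exists2 Phi : R -> R, Orlicz_function Phi &
    forall x : X,
      ereal_inf [set rho%:E | rho in [set rho : R | 0 < rho /\
        (\sum_(0 <= n <oo) (Phi (rnorm (coord_proj M n x) / rho))%:E <= 1)%E]]
      = (rnorm x)%:E.

(* Main.v *)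
Require Import Defs.
From mathcomp Require Import all_boot all_order all_algebra.
From mathcomp Require Import all_classical all_reals all_analysis.
From mathcomp Require Import ring lra.
Import Order.TTheory GRing.Theory Num.Theory.
Import numFieldNormedType.Exports.
Local Open Scope classical_set_scope.
Local Open Scope ring_scope.

(** The norm of a Schauder-Orlicz decomposition sees only the norms of the
    coordinates of [x], so changing the sign of one coordinate is an isometry:
    [U x = x - 2 P_n x] is an additive isometry of [L_p] which is [-1] on the
    range of [P_n] ([Schauder_Orlicz_reflection]).  The theorem therefore
    reduces to the following fact ([no_finite_rank_reflection]): when [p <> 2],
    a nonzero finite-dimensional subspace of [L_p(0,1)] cannot be the range of
    such a [P_n].

    For [p <> 2] the identity
    [|f+g|^p + |f-g|^p = 2 (|f|^p + |g|^p)] between norms characterises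
    functions with disjoint supports ([energy_parallelogram_disjoint]): the
    corresponding pointwise inequality has a constant sign, and it is strict
    where both functions are nonzero ([clarkson]).  Hence [U] preserves
    disjointness.

    Let [e] be a nonzero element of the range, so that [U e = - e].  Split [e]
    into its restrictions [e_A] and [e - e_A] to a set [A] and to its
    complement.  Their images are disjoint and add up to [- e], so [U e_A] takes
    only the values [0] and [- e] ([reflection_cutoff]).  Thus
    [2 P_n e_A = e_A - U e_A] is [e] or [2 e] on [A], while off [A] it vanishes
    outside a set over which the integral of [|e|^p] is at most that of
    [|U e_A|^p], which equals that of [|e_A|^p].  Lebesgue measure has no atom,
    so this last integral can be positive and arbitrarily small
    ([interval_cutoff_small_energy]); choose sets [A_0, A_1, ...] along which it
    decreases rapidly.  Each vector [2 P_n e_(A_i)] then lives on a set too large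
    to be covered by the supports of the later ones, which makes any number of
    these vectors linearly independent ([small_sign_cutoffs_independent]),
    although they all belong to the range of [P_n]. *)

Set Implicit Arguments.
Unset Strict Implicit.
Unset Printing Implicit Defensive.

(** * The equality case of Clarkson's inequality *)

Section clarkson.
Context (R : realType).
Implicit Types q s t x y : R.

Lemma powRK q x : q != 0 -> 0 <= x -> (x `^ q) `^ q^-1 = x.
Proof. by move=> q0 x0; rewrite -powRrM mulfV// powRr1. Qed.

(** Write [x `^ q = x * x `^ (q - 1)] and enlarge the base of the second factor
    to [x + y]. *)
Lemma powR_superadditive q x y : 1 < q -> 0 < x -> 0 < y ->
  x `^ q + y `^ q < (x + y) `^ q.
Proof.
move=> q1 x0 y0; have q0 : 0 < q := lt_trans ltr01 q1.
have xy0 : 0 < x + y by rewrite addr_gt0.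
rewrite -(mulr_powRB1 (ltW x0) q0) -(mulr_powRB1 (ltW y0) q0).
rewrite -(mulr_powRB1 (ltW xy0) q0) mulrDl ltrD// ltr_pM2l//.
  by rewrite gt0_ltr_powR ?nnegrE ?subr_gt0 ?ltrDl// ltW.
by rewrite gt0_ltr_powR ?nnegrE ?subr_gt0 ?ltrDr// ltW.
Qed.

(** This is superadditivity for the exponent [q^-1], applied to [x `^ q] and
    [y `^ q]. *)
Lemma powR_subadditive q x y : 0 < q -> q < 1 -> 0 < x -> 0 < y ->
  (x + y) `^ q < x `^ q + y `^ q.
Proof.
move=> q0 q1 x0 y0; have q0' : q != 0 by rewrite gt_eqF.
have q1' : 1 < q^-1 by rewrite invf_gt1.
have := powR_superadditive q1' (powR_gt0 q x0) (powR_gt0 q y0).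
rewrite !powRK ?(ltW x0) ?(ltW y0)// => xy.
have := gt0_ltr_powR q0 _ _ xy; rewrite !nnegrE powR_ge0.
rewrite -powRrM mulVf// powRr1; last by rewrite addr_ge0// powR_ge0.
by apply => //; rewrite addr_ge0// ltW.
Qed.

Lemma powR_midpoint_convex q s t : 1 <= q -> 0 <= s -> 0 <= t ->
  ((s + t) / 2) `^ q <= (s `^ q + t `^ q) / 2.
Proof.
move=> q1 s0 t0.
have h0 : 0 <= 2^-1 :> R by [].
have h1 : 2^-1 <= 1 :> R by rewrite invf_le1// ler1n.
have avg (x y : R) : conv (Itv01 h0 h1) (x : R^o) (y : R^o) = (x + y) / 2.
  by rewrite convRE /= /unstable.onem; lra.
rewrite -!avg; apply: convex_powR => //; by rewrite inE /= in_itv/= andbT.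
Qed.

Lemma powR_midpoint_concave q s t : 0 < q -> q <= 1 -> 0 <= s -> 0 <= t ->
  (s `^ q + t `^ q) / 2 <= ((s + t) / 2) `^ q.
Proof.
move=> q0 q1 s0 t0; have q0' : q != 0 by rewrite gt_eqF.
have q1' : 1 <= q^-1 by rewrite invf_ge1.
have := powR_midpoint_convex q1' (powR_ge0 s q) (powR_ge0 t q).
rewrite !powRK// => st.
have h : 0 <= (s `^ q + t `^ q) / 2 by rewrite divr_ge0// addr_ge0// powR_ge0.
have := ge0_ler_powR (ltW q0) _ _ st; rewrite !nnegrE powR_ge0.
by rewrite -powRrM mulVf// powRr1//; apply => //; rewrite divr_ge0// addr_ge0.
Qed.

(** With [m = x + y] the midpoint of [s] and [t], both steps of
    [s^q + t^q >= 2 m^q >= 2 (x^q + y^q)] hold for [q > 1] (convexity, then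
    superadditivity) and both are reversed for [q < 1]; the second one is strict
    unless [x = 0] or [y = 0].  The constant [c] is the sign that lets the two
    cases share one statement. *)
Lemma powR_parallelogram q : 0 < q -> q != 1 -> exists2 c : R, c != 0 &
  forall x y s t, 0 <= x -> 0 <= y -> 0 <= s -> 0 <= t ->
    s + t = 2 * (x + y) ->
    let D := c * (s `^ q + t `^ q - 2 * (x `^ q + y `^ q)) in
    0 <= D /\ (D = 0 -> x = 0 \/ y = 0).
Proof.
move=> q0; rewrite neq_lt => /orP[q1|q1].
- exists (-1); first by rewrite oppr_eq0 oner_eq0.
  move=> x y s t x0 y0 s0 t0 st /=; rewrite mulN1r.
  have := powR_midpoint_concave q0 (ltW q1) s0 t0.
  rewrite (_ : (s + t) / 2 = x + y) => [st'|]; last by rewrite st mulrC mulKf.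
  have [x_eq0|x_neq0] := eqVneq x 0.
    by move: st'; rewrite x_eq0 add0r powR0 ?gt_eqF// => st'; split; [lra|left].
  have [y_eq0|y_neq0] := eqVneq y 0.
    by move: st'; rewrite y_eq0 addr0 powR0 ?gt_eqF// => st'; split; [lra|right].
  have x_gt0 : 0 < x by rewrite lt0r x_neq0.
  have y_gt0 : 0 < y by rewrite lt0r y_neq0.
  by have := powR_subadditive q0 q1 x_gt0 y_gt0 => xy; split; lra.
- exists 1; first by rewrite oner_eq0.
  move=> x y s t x0 y0 s0 t0 st /=; rewrite mul1r.
  have := powR_midpoint_convex (ltW q1) s0 t0.
  rewrite (_ : (s + t) / 2 = x + y) => [st'|]; last by rewrite st mulrC mulKf.
  have [x_eq0|x_neq0] := eqVneq x 0.
    by move: st'; rewrite x_eq0 add0r powR0 ?gt_eqF// => st'; split; [lra|left].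
  have [y_eq0|y_neq0] := eqVneq y 0.
    by move: st'; rewrite y_eq0 addr0 powR0 ?gt_eqF// => st'; split; [lra|right].
  have x_gt0 : 0 < x by rewrite lt0r x_neq0.
  have y_gt0 : 0 < y by rewrite lt0r y_neq0.
  by have := powR_superadditive q1 x_gt0 y_gt0 => xy; split; lra.
Qed.

Context (k : scalar_kind).
Implicit Types a b : scalar_field R k.

Lemma reN a : re (- a) = - re a.
Proof. by move: a; case: k => //= -[]. Qed.

Lemma imN a : im (- a) = - im a.
Proof. by move: a; case: k => [a|[? ?]]//=; rewrite oppr0. Qed.

Lemma rnorm_parallelogram a b :
  rnorm (a + b) ^+ 2 + rnorm (a - b) ^+ 2 = 2 * (rnorm a ^+ 2 + rnorm b ^+ 2).
Proof.
by rewrite !rnormE !sqr_sqrtr ?addr_ge0 ?sqr_ge0// !(reD, imD, reN, imN); ring.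
Qed.

(** By the parallelogram identity this is [powR_parallelogram] for the exponent
    [p / 2] and the squared moduli of [a], [b], [a + b] and [a - b]. *)
Lemma clarkson (p : R) : 0 < p -> p != 2 -> exists2 c : R, c != 0 &
  forall a b,
    let D := c * (rnorm (a + b) `^ p + rnorm (a - b) `^ p
                  - 2 * (rnorm a `^ p + rnorm b `^ p)) in
    0 <= D /\ (D = 0 -> a = 0 \/ b = 0).
Proof.
move=> p0 p2; have pE z : rnorm (z : scalar_field R k) `^ p =
    (rnorm z ^+ 2) `^ (p / 2).
  by rewrite -powR_mulrn ?rnorm_ge0// -powRrM mulrC divfK.
have [||c c0 cP] := @powR_parallelogram (p / 2).
- by rewrite divr_gt0.
- by apply: contra_neq p2 => /(congr1 ( *%R^~ 2)); rewrite divfK// mul1r.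
exists c => // a b /=; rewrite !pE.
have [] := cP (rnorm a ^+ 2) (rnorm b ^+ 2) (rnorm (a + b) ^+ 2)
  (rnorm (a - b) ^+ 2); rewrite ?sqr_ge0 ?rnorm_parallelogram//.
move=> D0 DP; split=> // /DP[] /eqP; rewrite sqrf_eq0 => /eqP/rnorm0_eq0 ->.
  by left.
by right.
Qed.
End clarkson.

(** * Integrals of p-th powers *)

Section Rintegral.
Context d (T : measurableType d) (R : realType).
Variable mu : {measure set T -> \bar R}.
Implicit Types f g : T -> R.

Lemma Rintegral_sum I (s : seq I) (P : pred I) (h : I -> T -> R) :
  (forall i, mu.-integrable setT (EFin \o h i)) ->
  mu.-integrable setT (EFin \o (fun x => \sum_(i <- s | P i) h i x)) /\
  \int[mu]_x (\sum_(i <- s | P i) h i x) = \sum_(i <- s | P i) \int[mu]_x h i x.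
Proof.
move=> hi; elim: s => [|i s [ihi ihE]].
  rewrite big_nil (_ : (fun x => _) = cst 0); last first.
    by apply/funext => x; rewrite big_nil.
  by split; [exact: integrable0|rewrite Rintegral_cst// mul0r].
rewrite big_cons (_ : (fun x => _) = fun x => if P i
    then h i x + \sum_(j <- s | P j) h j x else \sum_(j <- s | P j) h j x).
  case: ifP => // Pi; split; last by rewrite RintegralD// ihE.
  exact: (integrableD measurableT (hi i) ihi).
by apply/funext => x; rewrite big_cons.
Qed.

Lemma ae_le_Rintegral f g : (forall x, 0 <= f x) -> (forall x, 0 <= g x) ->
  mu.-integrable setT (EFin \o f) -> mu.-integrable setT (EFin \o g) ->
  {ae mu, forall x, f x <= g x} -> \int[mu]_x f x <= \int[mu]_x g x.
Proof.
move=> f0 g0 fi gi fg; rewrite /Rintegral fine_le//.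
- exact: integrable_fin_num.
- exact: integrable_fin_num.
apply: ae_ge0_le_integral => //=.
- by move=> x _; rewrite lee_fin.
- exact: measurable_int fi.
- by move=> x _; rewrite lee_fin.
- exact: measurable_int gi.
- by apply: filterS fg => x fgx _; rewrite lee_fin.
Qed.

Lemma Rintegral0_ae f : (forall x, 0 <= f x) ->
  mu.-integrable setT (EFin \o f) -> \int[mu]_x f x = 0 ->
  {ae mu, forall x, f x = 0}.
Proof.
move=> f0 fi fE.
have : (\int[mu]_x `|(EFin \o f) x| = 0)%E.
  under eq_integral => x _ do rewrite gee0_abs ?lee_fin//.
  by rewrite -[LHS]fineK ?integrable_fin_num// -[fine _]/(Rintegral _ _ _) fE.
move=> /(ae_eq_integral_abs mu measurableT (measurable_int _ fi)).
by apply: filterS => x /(_ I) [].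
Qed.

End Rintegral.

Section energy.
Context d (T : measurableType d) (R : realType).
Variable mu : {measure set T -> \bar R}.
Variables (k : scalar_kind) (p : R) (p1 : 1 <= p).
Local Notation K := (scalar_field R k).
Local Notation F := (scalar_LfunType mu k p1).
Implicit Types f g : F.

Let p_gt0 : 0 < p. Proof. exact: lt_le_trans p1. Qed.

Definition density f (x : T) : R := rnorm (f x) `^ p.

(** The [p]-th power of the norm; unlike the norm, it is additive over functions
    with disjoint supports. *)
Definition energy f : R := \int[mu]_x density f x.

Lemma density_ge0 f x : 0 <= density f x.
Proof. exact: powR_ge0. Qed.

Lemma integrable_density f : mu.-integrable setT (EFin \o density f).
Proof.
have /scalar_LfunP[_ _ Lf] := valP f.
apply: eq_integrable (Lfun_integrable p1 Lf) => //= x _.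
by rewrite ger0_norm ?rnorm_ge0.
Qed.

Lemma energyE f : energy f = scalar_Lnorm mu p f `^ p.
Proof.
apply: EFin_inj; rewrite -poweR_EFin scalar_Lnorm_fin powR_Lnorm ?gt_eqF//.
rewrite /energy /Rintegral fineK; last first.
  by apply: integrable_fin_num => //; exact: integrable_density.
by apply: eq_integral => x _ /=; rewrite ger0_norm ?rnorm_ge0.
Qed.

Lemma eq_energy f g : scalar_Lnorm mu p f = scalar_Lnorm mu p g ->
  energy f = energy g.
Proof. by rewrite !energyE => ->. Qed.

Lemma energy_ge0 f : 0 <= energy f.
Proof. by rewrite energyE powR_ge0. Qed.

Lemma le_energy_sum f I (s : seq I) (P : pred I) (h : I -> F) :
  {ae mu, forall x, density f x <= \sum_(i <- s | P i) density (h i) x} ->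
  energy f <= \sum_(i <- s | P i) energy (h i).
Proof.
move=> fh.
have [hi <-] := Rintegral_sum s P (fun i => integrable_density (h i)).
apply: ae_le_Rintegral => //; first exact: density_ge0.
  by move=> x; rewrite sumr_ge0// => i _; exact: density_ge0.
exact: integrable_density.
Qed.

Lemma energyN f : energy (- f) = energy f.
Proof.
apply: eq_Rintegral => x _; rewrite /density (_ : (- f) x = - f x)//.
by rewrite /rnorm normrN.
Qed.

Lemma energyD_disjoint f g : (forall x, f x = 0 \/ g x = 0) ->
  energy (f + g) = energy f + energy g.
Proof.
move=> fg; rewrite /energy -RintegralD//; try exact: integrable_density.
apply: eq_Rintegral => x _; rewrite /density scalar_Lfun_valD.
by have [->|->] := fg x; rewrite rnorm0 powR0 ?gt_eqF// ?add0r ?addr0.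
Qed.

(** The hypothesis says that the integral of the function [D] of constant sign
    vanishes. *)
Lemma energy_parallelogram_disjoint f g : p != 2 ->
  energy (f + g) + energy (f - g) = 2 * (energy f + energy g) ->
  {ae mu, forall x, f x = 0 \/ g x = 0}.
Proof.
move=> p2 Efg; have [c c0 cP] := clarkson k p_gt0 p2.
pose D x := c * (density (f + g) x + density (f - g) x
                 - 2 * (density f x + density g x)).
have iD h1 h2 : mu.-integrable setT (EFin \o h1) ->
    mu.-integrable setT (EFin \o h2) ->
    mu.-integrable setT (EFin \o (fun x => h1 x + h2 x : R)).
  by move=> i1 i2; exact: (integrableD measurableT i1 i2).
have iZ a h : mu.-integrable setT (EFin \o h) ->
    mu.-integrable setT (EFin \o (fun x => a * h x : R)).
  by move=> ih; exact: (integrableZl measurableT a ih).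
have iB h1 h2 : mu.-integrable setT (EFin \o h1) ->
    mu.-integrable setT (EFin \o h2) ->
    mu.-integrable setT (EFin \o (fun x => h1 x - h2 x : R)).
  by move=> i1 i2; exact: (integrableB measurableT i1 i2).
have id := integrable_density.
have : {ae mu, forall x, D x = 0}.
  apply: Rintegral0_ae.
  - by move=> x; case: (cP (f x) (g x)).
  - by apply/iZ/iB; [exact: iD|apply/iZ/iD].
  rewrite RintegralZl//; last by apply: iB; [exact: iD|apply/iZ/iD].
  rewrite RintegralB//; [|exact: iD|by apply/iZ/iD].
  rewrite RintegralZl//; last exact: iD.
  by rewrite !RintegralD// -!/(energy _) Efg subrr mulr0.
by apply: filterS => x; exact: (cP (f x) (g x)).2.
Qed.

Lemma cutoff_subproof (A : set T) (mA : measurable A) f :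
  (fun x => if x \in A then f x else 0) \in scalar_Lfun mu p1.
Proof.
have /scalar_LfunP[mr mi Lf] := valP f.
have mcut (h : K -> R) : h 0 = 0 -> measurable_fun setT (h \o f) ->
    measurable_fun setT (h \o (fun x => if x \in A then f x else 0)).
  move=> h0 mh; have /(measurable_restrictT _ mA) : measurable_fun A (h \o f).
    exact: measurable_funS mh.
  by congr measurable_fun; apply/funext => x; rewrite patchE /=; case: ifP.
apply/scalar_LfunP; split; [exact: mcut (re0 _ _) _|exact: mcut (im0 _ _) _|].
apply: (ge0_Lfun_le p1 _ Lf) => [|x].
  apply: measurable_rnorm; [exact: mcut (re0 _ _) _|exact: mcut (im0 _ _) _].
by rewrite rnorm_ge0/=; case: ifP => _ //; rewrite rnorm0 rnorm_ge0.
Qed.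

Definition cutoff (A : set T) (mA : measurable A) f : F :=
  ScalarLfun (cutoff_subproof mA f).

Lemma cutoffE (A : set T) (mA : measurable A) f x :
  cutoff mA f x = if x \in A then f x else 0.
Proof. by []. Qed.

End energy.

(** * Isometries of L_p preserve disjointness *)

Section isometry.
Context d (T : measurableType d) (R : realType).
Variable mu : {measure set T -> \bar R}.
Variables (k : scalar_kind) (p : R) (p1 : 1 <= p) (p2 : p != 2).
Local Notation K := (scalar_field R k).
Local Notation F := (scalar_LfunType mu k p1).
Local Notation X := (scalar_Lspace mu k p1).
Local Notation pi := (\pi_(X)%qT : F -> X).
Implicit Types f g : F.

Variables (U : X -> X) (UD : {morph U : x y / x + y})
  (Unorm : forall x, rnorm (U x) = rnorm x).

Let UB : {morph U : x y / x - y}.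
Proof.
by move=> x y; apply/(addIr (U y)); rewrite -UD !subrK.
Qed.

Lemma energy_isometry f g : U (pi f) = pi g -> energy g = energy f.
Proof. by move=> fg; apply: eq_energy; rewrite -!rnorm_pi -fg Unorm. Qed.

(** Disjoint functions satisfy the identity of [energy_parallelogram_disjoint],
    and [U] transports all four energies in it. *)
Lemma isometry_disjoint f g f' g' : U (pi f) = pi f' -> U (pi g) = pi g' ->
  (forall x, f x = 0 \/ g x = 0) -> {ae mu, forall x, f' x = 0 \/ g' x = 0}.
Proof.
move=> ff' gg' fg; apply: energy_parallelogram_disjoint => //.
have piB h1 h2 : pi (h1 - h2) = pi h1 - pi h2 by exact: raddfB.
rewrite (energy_isometry ff') (energy_isometry gg').
rewrite (@energy_isometry (f + g) (f' + g')); last first.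
  by rewrite -!Defs.pi_add UD ff' gg'.
rewrite (@energy_isometry (f - g) (f' - g')); last by rewrite !piB UB ff' gg'.
rewrite !energyD_disjoint// ?energyN; first by rewrite mulr2n mulrDl mul1r.
move=> x; have [->|gx] := fg x; first by left.
by right; rewrite -[LHS]/(- g x) gx oppr0.
Qed.

(** The images of the two pieces of [e] are disjoint with sum [- e], so at almost
    every point one of them is [0] and the other one is [- e]. *)
Lemma reflection_cutoff (e : F) (A : set T) (mA : measurable A) :
  U (pi e) = - pi e -> exists G : F,
    [/\ U (pi (cutoff mA e)) = pi G, energy G = energy (cutoff mA e) &
        {ae mu, forall x, G x = 0 \/ G x = - e x}].
Proof.
move=> Ue; set u := cutoff mA e.
have [G GE] := scalar_LspaceP (U (pi u)).
have [H HE] := scalar_LspaceP (U (pi (e - u))).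
exists G; split => //; first exact: energy_isometry.
have GH : {ae mu, forall x, G x = 0 \/ H x = 0}.
  apply: isometry_disjoint GE HE _ => x; rewrite scalar_Lfun_valB cutoffE.
  by case: ifP => _; [right; rewrite subrr|left].
have : pi (G + H) = pi (- e).
  by rewrite -Defs.pi_add -GE -HE -UD Defs.pi_add addrC subrK Ue raddfN.
move=> /scalar_Lspace_eqP; apply: filterS2 GH => x GHx.
rewrite scalar_Lfun_valD => GHe.
by case: GHx => [|Hx]; [left|right; move: GHe; rewrite Hx addr0].
Qed.

End isometry.

(** * Reflections of finite rank *)

(** Take [s i] small with respect to a threshold [t i], where [t i.+1] is
    [phi (s i) / N]. *)
Lemma rapidly_decreasing_sequence (R : realFieldType) (S : Type) (phi : S -> R)
  (N : R) : 1 <= N ->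
  (forall eps, 0 < eps -> exists s, 0 < phi s < eps) ->
  exists s : nat -> S, (forall i, 0 < phi (s i)) /\
    forall i j, (i < j)%N -> phi (s j) < phi (s i) / N.
Proof.
move=> N1 small; have N0 : 0 < N := lt_le_trans ltr01 N1.
have [g gP] : {g : R -> S & forall eps, 0 < eps -> 0 < phi (g eps) < eps}.
  apply: (@choice _ _ (fun eps s => 0 < eps -> 0 < phi s < eps)) => eps.
  have [/small[s]|_] := ltP 0 eps; first by exists s.
  by have [s _] := small 1 ltr01; exists s.
pose t := fix t i := if i is j.+1 then phi (g (t j)) / N else 1.
have t0 i : 0 < t i.
  by elim: i => //= i ti; rewrite divr_gt0//; case/andP: (gP _ ti).
exists (g \o t); split=> [i|i j]; first by case/andP: (gP _ (t0 i)).
have step l : phi (g (t l.+1)) < phi (g (t l)) / N.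
  by case/andP: (gP _ (t0 l.+1)).
elim: j => // j IHj; rewrite ltnS leq_eqVlt => /predU1P[->|/IHj].
  exact: step.
apply: le_lt_trans; apply: le_trans (ltW (step j)) _.
by rewrite ler_pdivrMr// ler_peMr//; case/andP: (gP _ (t0 j)) => /ltW.
Qed.

Lemma linear_dependency (K : fieldType) (V : lmodType K) m (v : 'I_m -> V)
    (w : 'I_m.+1 -> V) :
  (forall j, exists a : 'I_m -> K, w j = \sum_(i < m) a i *: v i) ->
  exists2 c : 'I_m.+1 -> K, exists j, c j != 0 & \sum_j c j *: w j = 0.
Proof.
move=> /choice[a wE]; pose A := \matrix_(j, i) a j i.
have : kermx A != 0.
  rewrite -mxrank_eq0 mxrank_ker subn_eq0 -ltnNge ltnS; exact: rank_leq_col.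
move=> /rowV0Pn[c /sub_kermxP cA c0]; exists (c 0).
  by apply/existsP; apply: contra_neqT c0; rewrite negb_exists => /forallP c0;
    apply/rowP => j; rewrite mxE; apply/eqP; move: (c0 j); rewrite negbK.
under eq_bigr => j _ do rewrite wE scaler_sumr.
rewrite exchange_big big1//= => i _.
under eq_bigr => j _ do rewrite scalerA.
rewrite -scaler_suml; have /rowP/(_ i) := cA; rewrite !mxE => cAi.
by rewrite (eq_bigr (fun j => c 0 j * A j i)) ?cAi ?scale0r// => j _; rewrite mxE.
Qed.

Section reflection.
Context d (T : measurableType d) (R : realType).
Variable mu : {measure set T -> \bar R}.
Variables (k : scalar_kind) (p : R) (p1 : 1 <= p) (p2 : p != 2).
Local Notation K := (scalar_field R k).
Local Notation F := (scalar_LfunType mu k p1).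
Local Notation X := (scalar_Lspace mu k p1).
Local Notation pi := (\pi_(X)%qT : F -> X).
Implicit Types f g : F.

Let p_gt0 : 0 < p. Proof. exact: lt_le_trans p1. Qed.

Lemma pi_lincomb I (s : seq I) (c : I -> K) (f : I -> F) :
  \sum_(i <- s) c i *: pi (f i) = pi (\sum_(i <- s) c i *: f i).
Proof.
rewrite raddf_sum; apply: eq_bigr => i _; exact: pi_scale.
Qed.

Lemma scalar_Lfun_val_lincomb I (s : seq I) (c : I -> K) (f : I -> F) x :
  (\sum_(i <- s) c i *: f i) x = \sum_(i <- s) c i * f i x.
Proof.
elim: s => [|i s IHs]; first by rewrite !big_nil.
by rewrite !big_cons scalar_Lfun_valD IHs.
Qed.

(** In a vanishing combination, let [i] be the least index with a nonzero
    coefficient.  Wherever [u i] is nonzero the term of index [i] is a nonzero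
    multiple of [e], so some later [u j] or [G j] is nonzero there and has the
    same modulus [|e|] as [u i].  Integrating, the energy of [u i] is at most the
    sum of those of all later [u j] and [G j], which are too small for that. *)
Lemma small_sign_cutoffs_independent n (e : F) (u G : 'I_n -> F) :
  (forall j, {ae mu, forall x, u j x = 0 \/ u j x = e x}) ->
  (forall j, {ae mu, forall x, G j x = 0 \/ G j x = - e x}) ->
  (forall i j : 'I_n, (i < j)%N ->
     energy (u j) + energy (G j) < energy (u i) / n%:R) ->
  (forall i, 0 < energy (u i)) ->
  forall c : 'I_n -> K, \sum_j c j *: pi (u j - G j) = 0 ->
  forall i, c i = 0.
Proof.
move=> ue Ge decr u0 c.
rewrite pi_lincomb -[RHS](raddf0 pi) => /scalar_Lspace_eqP sum0.
have [//|/existsNP[i0 /eqP ci0]] := pselect (forall i, c i = 0).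
case: (@arg_minnP _ i0 (fun i => c i != 0) (@nat_of_ord n) ci0) => i /= ci imin.
(* [h] lists all the functions [u j] and [G j] in a single family *)
pose h (q : 'I_n * bool) := if q.2 then u q.1 else G q.1.
have : energy (u i) <= \sum_(q : 'I_n * bool | (i < q.1)%N && true) energy (h q).
  apply: le_energy_sum.
  have ue' := filter_forall (ae_filter_ringOfSetsType mu) ue.
  have Ge' := filter_forall (ae_filter_ringOfSetsType mu) Ge.
  apply: filterS3 sum0 ue' Ge' => x sum0 ue' Ge'.
  have sum_ge0 : 0 <= \sum_(q : 'I_n * bool | (i < q.1)%N && true) density (h q) x.
    by rewrite sumr_ge0// => q _; exact: density_ge0.
  have [ui0|uie] := ue' i.
    by rewrite {1}/density ui0 rnorm0 powR0 ?gt_eqF.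
  have [ex0|ex0] := eqVneq (e x) 0.
    by rewrite {1}/density uie ex0 rnorm0 powR0 ?gt_eqF.
  suff [q iq hq] : exists2 q : 'I_n * bool, (i < q.1)%N &
      density (h q) x = density (u i) x.
    rewrite -hq (bigD1 q) ?iq//= lerDl sumr_ge0// => r _; exact: density_ge0.
  have [//|no] := pselect (exists2 q : 'I_n * bool, (i < q.1)%N &
      density (h q) x = density (u i) x).
  exfalso.
  have later (j : 'I_n) : (i < j)%N -> u j x - G j x = 0.
    move=> ij; have [uj|uj] := ue' j; last first.
      by case: no; exists (j, true) => //; rewrite /density /h/= uj uie.
    have [Gj|Gj] := Ge' j; first by rewrite uj Gj subrr.
    case: no; exists (j, false) => //.
    by rewrite /density /h/= Gj uie /rnorm normrN.
  move: sum0; rewrite scalar_Lfun_val_lincomb (bigD1 i)// big1 => [|j /andP[_ ji]].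
    move=> sum0i; have /eqP : c i * (u i - G i) x = 0.
      by rewrite -[LHS]addr0; exact: sum0i.
    rewrite mulf_eq0 (negbTE ci) orFb scalar_Lfun_valB uie.
    have [->|->] := Ge' i; first by rewrite subr0 (negbTE ex0).
    by rewrite opprK -mulr2n mulrn_eq0 (negbTE ex0).
  have [cj|/imin ij] := eqVneq (c j) 0; first by rewrite cj mul0r.
  by rewrite scalar_Lfun_valB later ?mulr0// ltn_neqAle ij andbT eq_sym.
rewrite -(pair_big_dep (fun j : 'I_n => (i < j)%N) (fun _ _ => true)
  (fun j b => energy (h (j, b))))/=.
have n0 : (0 : R) < n%:R by rewrite ltr0n (leq_ltn_trans _ (ltn_ord i)).
have Ein : 0 < energy (u i) / n%:R by rewrite divr_gt0.
move=> le_sum; exfalso; move: le_sum; apply/negP; rewrite -ltNge.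
have : \sum_(j : 'I_n) energy (u i) / n%:R = energy (u i).
  by rewrite sumr_const card_ord -[LHS]mulr_natr divfK ?gt_eqF.
rewrite (bigD1 i)//= => EE; rewrite -[ltRHS]EE.
(* index [i] itself is not among the later ones: its share makes it strict *)
rewrite -[ltLHS]add0r ltr_leD//.
rewrite big_mkcond [leRHS]big_mkcond; apply: ler_sum => j _.
have [->|ji] := eqVneq j i; first by rewrite ltnn.
case: ifP => [ij|_]; last exact: ltW.
by rewrite big_bool; exact/ltW/decr.
Qed.

(** The first hypothesis is how the absence of atoms is used: every nonzero
    function has a nonzero restriction of arbitrarily small energy. *)
Theorem no_finite_rank_reflection (E : set X) (P : X -> X) :
  (forall f, 0 < energy f -> forall eps, 0 < eps ->
     exists A : {A : set T | measurable A},
       0 < energy (cutoff (svalP A) f) < eps) ->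
  {morph P : x y / x + y} -> (forall x, E (P x)) ->
  (forall x, E x -> P x = x) ->
  (forall x, rnorm (x - P x *+ 2) = rnorm x) ->
  finite_dimensional E -> forall x, E x -> x = 0.
Proof.
move=> small PD PE Pid Pnorm [m [v [_ vspan]]] x Ex.
have [//|x0] := eqVneq x 0; exfalso.
have [e xe] := scalar_LspaceP x.
pose U y := y - P y *+ 2.
have UD : {morph U : y z / y + z}.
  by move=> y z; rewrite /U PD mulrnDl opprD addrACA.
have Ue : U (pi e) = - pi e.
  by rewrite /U -xe Pid// mulr2n opprD addrA subrr sub0r.
have e0 : 0 < energy e.
  rewrite energyE powR_gt0// lt_neqAle fine_ge0 ?Lnorm_ge0// andbT eq_sym.
  apply: contra_neq x0 => e0; apply: Lspace_norm0_eq0.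
  by rewrite xe Lspace_norm_pi e0 of_real0.
(* one vector more than the span allows, and two energies for each of them *)
have N1 : 1 <= (m.+1 * 2)%:R :> R by rewrite ler1n muln_gt0.
have [A [A0 Adecr]] := rapidly_decreasing_sequence N1 (small _ e0).
pose u (j : 'I_m.+1) := cutoff (svalP (A j)) e.
have /choice[G GP] : forall j, exists G : F,
    [/\ U (pi (u j)) = pi G, energy G = energy (u j) &
        {ae mu, forall x, G x = 0 \/ G x = - e x}].
  by move=> j; exact: reflection_cutoff.
have [j|c [i ci]] := @linear_dependency K X m v (fun j => P (pi (u j))).
  exact: vspan.
move=> sumc; apply/negP: ci; rewrite negbK; apply/eqP.
apply: (@small_sign_cutoffs_independent _ e u G) => [j|j|i' j ij|j|].
- by apply: aeW => y; rewrite cutoffE; case: ifP => _; [right|left].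
- by case: (GP j).
- have [_ -> _] := GP j; have := Adecr _ _ ij; rewrite -/(u j) -/(u i').
  by rewrite natrM invfM mulrA /= /u => ltj;
    set b := _ / _; move: ltj; rewrite -/b; lra.
- exact: A0.
transitivity ((\sum_j c j *: P (pi (u j))) *+ 2); last by rewrite sumc mul0rn.
rewrite -sumrMnl; apply: eq_bigr => j _; rewrite scalerMnr; congr (_ *: _).
by rewrite raddfB/=; have [<- _ _] := GP j; rewrite /U subKr.
Qed.
End reflection.

(** * Restrictions of small energy *)

Section nonatomic.
Context (R : realType) (k : scalar_kind) (p : R) (p1 : 1 <= p).
Local Notation mu := (mrestr (@lebesgue_measure R) (measurable_itv `]0%R, 1%R[)).
Local Notation F := (scalar_LfunType mu k p1).

Lemma energy_cutoff d (T : measurableType d) (nu : {measure set T -> \bar R})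
    (f : scalar_LfunType nu k p1) (A : set T) (mA : measurable A) :
  energy (cutoff mA f) = \int[nu]_(x in A) density f x.
Proof.
rewrite Rintegral_mkcond; apply: eq_Rintegral => x _.
rewrite patchE /density cutoffE; case: ifP => // _.
by rewrite rnorm0 powR0 // gt_eqF// (lt_le_trans _ p1).
Qed.

(** Absolute continuity of the integral: the restrictions of [f] to the
    intervals [[i/N, (i+1)/N[] have energy below [eps] as soon as [1/N] is small,
    and they cannot all have zero energy since they add up to [f]. *)
Lemma interval_cutoff_small_energy (f : F) : 0 < energy f ->
  forall eps, 0 < eps ->
  exists A : {A : set (measurableTypeR R) | measurable A},
    0 < energy (cutoff (svalP A) f) < eps.
Proof.
move=> f0 eps eps0.
have [d [d0 dP]] := integral_normr_continuous (integrable_density f) eps0.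
have [n nd] : exists n : nat, n.+1%:R^-1 < d.
  exists (Num.truncn d^-1).
  by rewrite invf_plt ?posrE// truncnS_gt.
pose A (i : 'I_n.+1) : set (measurableTypeR R) :=
  `[i%:R / n.+1%:R, i.+1%:R / n.+1%:R[%classic.
have mA i : measurable (A i) by exact: measurable_itv.
have small i : energy (cutoff (mA i) f) < eps.
  rewrite energy_cutoff.
  have := dP (A i) (mA i).
  under eq_Rintegral => x _ do rewrite ger0_norm ?density_ge0//.
  apply.
  apply: le_lt_trans (_ : (n.+1%:R^-1)%:E < _)%E; last by rewrite lte_fin.
  rewrite /mrestr.
  apply: le_trans (_ : lebesgue_measure (A i) <= _)%E.
    by apply: le_measure; rewrite ?inE//; exact: measurableI.
  rewrite /A lebesgue_measure_itv/= lte_fin.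
  rewrite ltr_pM2r ?invr_gt0// ltr_nat ltnSn -EFinB lee_fin.
  by rewrite -mulrBl -natrB// subSnn mul1r.
have [[i Ai]|no] := pselect (exists i, 0 < energy (cutoff (mA i) f)).
  by exists (exist _ (A i) (mA i)); rewrite /= Ai small.
have : energy f <= \sum_(i < n.+1) energy (cutoff (mA i) f).
  apply: le_energy_sum.
  exists (~` `]0, 1[%classic); split.
  - exact: measurableC.
  - by rewrite /= /mrestr setICl measure0.
  move=> x /=; apply: contra_not => /=; rewrite in_itv/= => /andP[x0 x1].
  have xn : (Num.truncn (x * n.+1%:R) < n.+1)%N.
    rewrite truncn_lt_nat ?mulr_ge0 ?(ltW x0)//.
    by rewrite gtr_pMl.
  rewrite (bigD1 (Ordinal xn))//=.
  have -> : density f x = density (cutoff (mA (Ordinal xn)) f) x.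
    rewrite {2}/density cutoffE ifT// inE /A /= in_itv/=.
    rewrite ler_pdivrMr// ltr_pdivlMr//.
    by rewrite truncn_itv// mulr_ge0// ltW.
  by rewrite lerDl sumr_ge0// => i _; exact: density_ge0.
rewrite big1 => [|i _]; first by rewrite leNgt f0.
apply/eqP; rewrite eq_le energy_ge0 andbT leNgt.
by apply/negP => Ai; apply: no; exists i.
Qed.

End nonatomic.

(** * Sign changes of one coordinate *)

Section Schauder.
Context (K : numFieldType) (X : normedModType K) (M : nat -> set X).
Hypothesis MS : Schauder_decomposition M.
Implicit Types x y : X.

Lemma coord_proj_unique x u : expansion M x u ->
  (fun n => coord_proj M n x) = u.
Proof.
move=> xu; have [w [_ wP]] := MS.2 x.
by rewrite -(wP _ xu) -(wP _ (coord_projP x MS)).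
Qed.

Lemma summandD n x y : M n x -> M n y -> M n (x + y).
Proof.
move=> /mem_set Mx /mem_set My; have [[_ sub] _ _] := MS.1 n.
by apply: set_mem; have := sub 1 x y Mx My; rewrite scale1r.
Qed.

Lemma summand0 n : M n 0.
Proof. by have [[zero _] _ _] := MS.1 n; exact: set_mem. Qed.

Lemma summandZ n a x : M n x -> M n (a *: x).
Proof.
move=> /mem_set Mx; have [[_ sub] _ _] := MS.1 n.
by apply: set_mem; have := sub a x 0 Mx (mem_set (summand0 n)); rewrite addr0.
Qed.

Lemma coord_projD n : {morph coord_proj M n : x y / x + y}.
Proof.
move=> x y; pose w n := coord_proj M n x + coord_proj M n y.
have [Mx xE] := coord_projP x MS; have [My yE] := coord_projP y MS.
suff /coord_proj_unique/(congr1 (fun u => u n)) : expansion M (x + y) w by [].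
split=> [i|]; first exact: summandD.
have -> : series w = series (fun n => coord_proj M n x) \+
                     series (fun n => coord_proj M n y).
  by apply/funext => i; rewrite /series/= big_split.
exact: cvgD.
Qed.

Lemma expansion_summand n x : M n x ->
  expansion M x (fun i => if i == n then x else 0).
Proof.
move=> Mx; split=> [i|].
  by case: eqP => [->//|_]; exact: summand0.
apply: cvg_near_cst; exists n.+1 => // i /= ni; apply/esym.
rewrite /series/= big_mkord (bigD1 (Ordinal ni))//= eqxx big1 ?addr0// => j jn.
by rewrite ifN.
Qed.

Lemma coord_proj_summand n i x : M n x ->
  coord_proj M i x = if i == n then x else 0.
Proof. by move=> /expansion_summand/coord_proj_unique/(congr1 (fun u => u i)). Qed.

Lemma coord_projE n x : M n (coord_proj M n x).
Proof. exact: (coord_projP x MS).1. Qed.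

Lemma coord_proj_reflection n i x :
  coord_proj M i (x - coord_proj M n x *+ 2) =
  if i == n then - coord_proj M i x else coord_proj M i x.
Proof.
have N2 : - (coord_proj M n x *+ 2) = (- 2%:R) *: coord_proj M n x.
  by rewrite scaleNr scaler_nat.
rewrite N2 coord_projD (coord_proj_summand _ (summandZ _ (coord_projE n x))).
case: eqP => [->|_]; last by rewrite addr0.
by rewrite -N2 mulr2n opprD addrA subrr sub0r.
Qed.

End Schauder.

(** The reflected vector has the same coordinates up to sign, so the two infima
    that give the norms range over the same set. *)
Lemma Schauder_Orlicz_reflection (R : realType) (k : scalar_kind)
    (X : normedModType (scalar_field R k)) (M : nat -> set X) n x :
  Schauder_Orlicz_decomposition M ->
  rnorm (x - coord_proj M n x *+ 2) = rnorm x.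
Proof.
move=> [MS [Phi _ normE]]; apply: EFin_inj; rewrite -!normE.
congr ereal_inf; congr image; apply/funext => rho /=; congr (_ /\ (_ <= _)%E).
congr (limn _); apply/funext => N; apply: eq_bigr => i _.
rewrite coord_proj_reflection//; case: ifP => // _.
by rewrite /rnorm normrN.
Qed.

Theorem theorem23 (R : realType) (k : scalar_kind) (p : R)
    (p1 : 1 <= p) (p2 : p != 2) :
  ~ exists M : nat -> set (Lp01 k p1),
      Schauder_Orlicz_decomposition M /\
      exists n : nat, finite_dimensional (M n).
Proof.
move=> [M [MSO [n Mfin]]]; have MS := MSO.1.
have [_ _ [e Me /eqP[]]] := MS.1 n.
apply: (no_finite_rank_reflection p2 (E := M n) (P := coord_proj M n)) => //.
- exact: interval_cutoff_small_energy.
- exact: coord_projD.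
- exact: coord_projE.
- by move=> x Mx; rewrite (coord_proj_summand MS _ Mx) eqxx.
- by move=> x; exact: Schauder_Orlicz_reflection.
Qed.
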